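(* Let $\mathbb{F}_q$ be a finite field of odd characteristic and let $\epsilon,\delta\in\mathbb{F}_q$ with $\epsilon(\delta^2-\epsilon)\neq 0$ and $\chi(\delta^2-\epsilon)=1$. Fix a square root $\sqrt{\delta^2-\epsilon}\in\mathbb{F}_q$. Then the Jacobi quartic curve $J_{\epsilon,\delta}: y^2=\epsilon x^4+2\delta x^2+1$ over $\mathbb{F}_q$ has dADD-M formulas with the function $$w(x,y)=2\sqrt{\delta^2-\epsilon}\;\frac{x^2}{y^2}$$ and $e=\dfrac{2(\delta+\sqrt{\delta^2-\epsilon})}{\sqrt{\delta^2-\epsilon}}$; that is, $w$ is an inverted Montgomery-like function on $J_{\epsilon,\delta}$ with parameter $e$.
   Context: $\chi$ is the quadratic character of $\mathbb{F}_q$: for $a\ne0$, $\chi(a)=1$ if $a$ is a square in $\mathbb{F}_q$ and $\chi(a)=-1$ otherwise. The Jacobi quartic curve $J_{\epsilon,\delta}$ is regarded as an elliptic curve through its smooth projective model $X^2=TZ$, $Y^2=\epsilon T^2+2\delta X^2+Z^2$ in $\mathbb{P}^3$ with coordinates $(X:Y:T:Z)$, the affine point $(x,y)$ being $(x:y:x^2:1)$; the points with $Z=0$ are $(0:\pm\sqrt{\epsilon}:1:0)$. The identity is $(0,1)$, $-(x,y)=(-x,y)$, and addition is generically $$(x_1,y_1)+(x_2,y_2)=\left(\frac{x_1y_2+x_2y_1}{1-\epsilon x_1^2x_2^2},\ \frac{(y_1y_2+2\delta x_1x_2)(1+\epsilon x_1^2x_2^2)+2\epsilon x_1x_2(x_1^2+x_2^2)}{(1-\epsilon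 x_1^2x_2^2)^2}\right).$$ Inverted Montgomery-like function: let $E$ be an elliptic curve over a field $\mathbb{F}$ of characteristic $\neq2$ and $w$ a rational function on $E$ with $w(P)=w(-P)$ for all $P$. View $w(P)$ in $\mathbb{P}^1(\mathbb{F})$ as $(w(P):1)$ if $w$ is regular at $P$ and $(1:0)$ otherwise. For $P_1,P_2\in E(\mathbb{F})$ put $(W_0:Z_0)=w(P_2-P_1)$, $(W_1:Z_1)=w(P_1)$, $(W_2:Z_2)=w(P_2)$, $(W_3:Z_3)=w(P_1+P_2)$, $(W_4:Z_4)=w(2P_1)$. Then $w$ is an inverted Montgomery-like function with parameter $e\in\mathbb{F}$ if for all $P_1,P_2\in E(\mathbb{F})$ with $W_0Z_0\neq0$, $$(W_4:Z_4)=\big(4W_1Z_1((W_1+Z_1)^2-eW_1Z_1):(W_1^2-Z_1^2)^2\big),$$ $$(W_3:Z_3)=\big(Z_0(W_1Z_2-W_2Z_1)^2:W_0(W_1W_2-Z_1Z_2)^2\big).$$ (Equivalently $1/w$ is a Montgomery-like function, given by the same formulas with the two coordinates swapped; a curve with such a function is said to have dADD-M formulas.) *)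

(* Defs.v *)
From HB Require Import structures.
From mathcomp Require Import all_boot all_order all_algebra.
From mathcomp Require Import ring mpoly.
Set Implicit Arguments.
Unset Strict Implicit.
Unset Printing Implicit Defensive.
Import GRing.Theory.
Local Open Scope ring_scope.

Definition quad_char (F : finFieldType) (a : F) : int :=
  if a == 0 then 0 else if [exists b : F, b ^+ 2 == a] then 1 else -1.

(* Equality in P^1.  It is applied with a pair (W : Z) != (0, 0) on the left,
   and then entails that the pair on the right is nonzero as well. *)
Definition P1_eq (F : fieldType) (a b : F * F) : Prop :=
  exists2 k : F, k != 0 & a = (k * b.1, k * b.2).

Section JacobiQuartic.
Variables (F : fieldType) (eps delta : F).
Implicit Types (P Q : 'rV[F]_4) (f g : {mpoly F[4]}).
Implicit Types w u : {mpoly F[4]} * {mpoly F[4]}.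

(* Homogeneous coordinates (X : Y : T : Z) of P^3. *)
Definition iX : 'I_4 := 0.
Definition iY : 'I_4 := 1.
Definition iT : 'I_4 := 2.
Definition iZ : 'I_4 := 3.

Definition mkpt (x y t z : F) : 'rV[F]_4 := \row_i [:: x; y; t; z]`_i.

Definition jq_eq1 : {mpoly F[4]} := 'X_iX ^+ 2 - 'X_iT * 'X_iZ.
Definition jq_eq2 : {mpoly F[4]} :=
  'X_iY ^+ 2
  - (eps *: 'X_iT ^+ 2 + (2 * delta) *: 'X_iX ^+ 2 + 'X_iZ ^+ 2).

(* Points of the curve over F are represented by nonzero coordinate vectors,
   up to a nonzero scalar. *)
Definition proj_eq P Q : Prop := exists2 k : F, k != 0 & P = k *: Q.

Definition on_jq P : bool :=
  [&& P != 0, jq_eq1.@[P 0] == 0 & jq_eq2.@[P 0] == 0].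

Definition jq_opp P : 'rV[F]_4 := mkpt (- P 0 iX) (P 0 iY) (P 0 iT) (P 0 iZ).

(* The generic addition formula, cleared of denominators. *)
Definition jq_law1 P Q : 'rV[F]_4 :=
  let: (X1, Y1, T1, Z1) := (P 0 iX, P 0 iY, P 0 iT, P 0 iZ) in
  let: (X2, Y2, T2, Z2) := (Q 0 iX, Q 0 iY, Q 0 iT, Q 0 iZ) in
  let n := X1 * Y2 + X2 * Y1 in
  let d := Z1 * Z2 - eps * (T1 * T2) in
  mkpt (n * d)
       ((Y1 * Y2 + 2 * delta * (X1 * X2)) * (Z1 * Z2 + eps * (T1 * T2))
        + 2 * eps * (X1 * X2) * (T1 * Z2 + T2 * Z1))
       (n ^+ 2) (d ^+ 2).

(* A second expression of the same addition map, which in affine form is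
     x3 = (x1^2 - x2^2) / (x1 y2 - x2 y1),
     y3 = ((y1 y2 - 2 delta x1 x2) (x1^2 + x2^2)
            - 2 x1 x2 (1 + eps x1^2 x2^2)) / (x1 y2 - x2 y1)^2.
   On the smooth curve the two expressions are proportional and never vanish
   simultaneously (jq_laws_agree, jq_add_on below), so that together they
   give the addition morphism on all pairs of points: jq_law1 alone vanishes
   when P - Q is one of the points (0 : +-sqrt eps : 1 : 0). *)
Definition jq_law2 P Q : 'rV[F]_4 :=
  let: (X1, Y1, T1, Z1) := (P 0 iX, P 0 iY, P 0 iT, P 0 iZ) in
  let: (X2, Y2, T2, Z2) := (Q 0 iX, Q 0 iY, Q 0 iT, Q 0 iZ) in
  let n := T1 * Z2 - T2 * Z1 in
  let d := X1 * Y2 - X2 * Y1 in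
  mkpt (n * d)
       ((Y1 * Y2 - 2 * delta * (X1 * X2)) * (T1 * Z2 + T2 * Z1)
        - 2 * (X1 * X2) * (Z1 * Z2 + eps * (T1 * T2)))
       (n ^+ 2) (d ^+ 2).

Definition jq_add P Q : 'rV[F]_4 :=
  if jq_law1 P Q == 0 then jq_law2 P Q else jq_law1 P Q.

(* The ideal generated by the two quadrics.  It is prime when 2 and
   eps * (delta^2 - eps) are nonzero, so that its homogeneous quotient ring
   is the homogeneous coordinate ring of the curve. *)
Definition jq_ideal f : Prop :=
  exists a b : {mpoly F[4]}, f = a * jq_eq1 + b * jq_eq2.

(* Rational functions on the curve: fractions w.1 / w.2 of homogeneous
   polynomials of the same degree, w.2 not vanishing identically on the
   curve. *)
Definition jq_ratfun w : Prop :=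
  ~ jq_ideal w.2 /\ exists d : nat, w.1 \is d.-homog /\ w.2 \is d.-homog.

Definition jq_ratfun_eq w u : Prop := jq_ideal (w.1 * u.2 - u.1 * w.2).

(* u is a fraction representing w whose denominator does not vanish at P. *)
Definition jq_regular_rep w P u : Prop :=
  [/\ jq_ratfun u, jq_ratfun_eq w u & u.2.@[P 0] != 0].

Definition jq_regular w P : Prop := exists u, jq_regular_rep w P u.

(* c is a pair of homogeneous coordinates of w(P), seen in P^1(F). *)
Definition jq_value w P (c : F * F) : Prop :=
  (exists2 u, jq_regular_rep w P u & P1_eq c (u.1.@[P 0] / u.2.@[P 0], 1))
  \/ (~ jq_regular w P /\ P1_eq c (1, 0)).

(* The composite of w with P |-> - P, by substitution. *)
Definition jq_ratfun_opp w : {mpoly F[4]} * {mpoly F[4]} :=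
  let lq := [tuple - 'X_iX; 'X_iY; 'X_iT; 'X_iZ] : 4.-tuple {mpoly F[4]} in
  (w.1 \mPo lq, w.2 \mPo lq).

(* Evenness is an identity of rational functions, i.e. it holds at all
   geometric points and not merely at the F-rational ones. *)
Definition jq_even w : Prop := jq_ratfun_eq w (jq_ratfun_opp w).

Definition inverted_montgomery_like w (e : F) : Prop :=
  [/\ jq_ratfun w, jq_even w &
  forall P1 P2, on_jq P1 -> on_jq P2 ->
  forall W0 Z0 W1 Z1 W2 Z2 W3 Z3 W4 Z4 : F,
    jq_value w (jq_add P2 (jq_opp P1)) (W0, Z0) ->
    jq_value w P1 (W1, Z1) ->
    jq_value w P2 (W2, Z2) ->
    jq_value w (jq_add P1 P2) (W3, Z3) ->
    jq_value w (jq_add P1 P1) (W4, Z4) ->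
    W0 * Z0 != 0 ->
    P1_eq (W4, Z4) (4 * W1 * Z1 * ((W1 + Z1) ^+ 2 - e * W1 * Z1),
                    (W1 ^+ 2 - Z1 ^+ 2) ^+ 2)
    /\ P1_eq (W3, Z3) (Z0 * (W1 * Z2 - W2 * Z1) ^+ 2,
                       W0 * (W1 * W2 - Z1 * Z2) ^+ 2)].

(* The function c * x^2 / y^2, where x = X / Z and y = Y / Z. *)
Definition jq_x2y2 (c : F) : {mpoly F[4]} * {mpoly F[4]} :=
  (c *: 'X_iX ^+ 2, 'X_iY ^+ 2).

Lemma mkptE x y t z :
  ((mkpt x y t z 0 iX = x) * (mkpt x y t z 0 iY = y)
  * (mkpt x y t z 0 iT = t) * (mkpt x y t z 0 iZ = z))%type.
Proof. by rewrite !mxE. Qed.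

Lemma pt_eqP P Q : P 0 iX = Q 0 iX -> P 0 iY = Q 0 iY ->
  P 0 iT = Q 0 iT -> P 0 iZ = Q 0 iZ -> P = Q.
Proof.
move=> hX hY hT hZ; apply/rowP; case=> [[|[|[|[|//]]]] hi];
  [move: hX | move: hY | move: hT | move: hZ];
  by congr (P 0 _ = Q 0 _); apply: val_inj.
Qed.

Lemma on_jqE P : on_jq P =
  [&& P != 0, P 0 iX ^+ 2 == P 0 iT * P 0 iZ &
    P 0 iY ^+ 2 == eps * P 0 iT ^+ 2 + 2 * delta * P 0 iX ^+ 2 + P 0 iZ ^+ 2].
Proof.
by rewrite /on_jq /jq_eq1 /jq_eq2 !(mevalB, mevalD, mevalZ, mevalM, rmorphXn)
  /= !mevalXU !subr_eq0.
Qed.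

Lemma jq_laws_agree P Q i j : on_jq P -> on_jq Q ->
  jq_law1 P Q 0 i * jq_law2 P Q 0 j = jq_law1 P Q 0 j * jq_law2 P Q 0 i.
Proof.
rewrite !on_jqE => /and3P[_ /eqP hX1 /eqP hY1] /and3P[_ /eqP hX2 /eqP hY2].
rewrite /jq_law1 /jq_law2 [mkpt]lock.
move: (P 0 iX) (P 0 iY) (P 0 iT) (P 0 iZ) hX1 hY1 => X1 Y1 T1 Z1 hX1 hY1.
move: (Q 0 iX) (Q 0 iY) (Q 0 iT) (Q 0 iZ) hX2 hY2 => X2 Y2 T2 Z2 hX2 hY2.
rewrite -lock !mxE; rewrite hX1 in hY1; rewrite hX2 in hY2.
by case: i => [[|[|[|[|//]]]] hi]; case: j => [[|[|[|[|//]]]] hj] /=;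
  ring: hX1 hY1 hX2 hY2.
Qed.

Lemma jq_add_on P Q :
  2 != 0 :> F -> eps != 0 -> delta ^+ 2 != eps ->
  on_jq P -> on_jq Q -> on_jq (jq_add P Q).
Proof.
move=> h2 he hd; rewrite !on_jqE => /and3P[hP /eqP hX1 /eqP hY1].
move=> /and3P[hQ /eqP hX2 /eqP hY2].
have ptN0 (R : 'rV[F]_4) : R 0 iX ^+ 2 = R 0 iT * R 0 iZ ->
    R 0 iY ^+ 2 = eps * R 0 iT ^+ 2 + 2 * delta * R 0 iX ^+ 2 + R 0 iZ ^+ 2 ->
    R != 0 -> R 0 iT = 0 -> R 0 iZ = 0 -> False.
  move=> hX hY /eqP hR hT hZ; apply: hR.
  have X0 : R 0 iX = 0 by apply/eqP; rewrite -sqrf_eq0 hX hT mul0r.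
  have Y0 : R 0 iY = 0.
    by apply/eqP; rewrite -sqrf_eq0 hY hT X0 hZ !expr0n /= !mulr0 !addr0.
  by apply: pt_eqP; rewrite ?mxE.
have := ptN0 _ hX2 hY2 hQ; have := ptN0 _ hX1 hY1 hP.
rewrite /jq_add; have [l10|l1N0] := boolP (jq_law1 P Q == 0); last first.
  move=> _ _; rewrite l1N0 /=; move: hX1 hY1 hX2 hY2; rewrite /jq_law1.
  move: (P 0 iX) (P 0 iY) (P 0 iT) (P 0 iZ) => X1 Y1 T1 Z1 hX1 hY1.
  move: (Q 0 iX) (Q 0 iY) (Q 0 iT) (Q 0 iZ) => X2 Y2 T2 Z2 hX2 hY2.
  rewrite hX1 in hY1; rewrite hX2 in hY2.
  by rewrite !mkptE; apply/andP; split; apply/eqP; ring: hX1 hY1 hX2 hY2.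
move=> ptP ptQ; apply/andP; split; last first.
  move: hX1 hY1 hX2 hY2; rewrite /jq_law2.
  move: (P 0 iX) (P 0 iY) (P 0 iT) (P 0 iZ) => X1 Y1 T1 Z1 hX1 hY1.
  move: (Q 0 iX) (Q 0 iY) (Q 0 iT) (Q 0 iZ) => X2 Y2 T2 Z2 hX2 hY2.
  rewrite hX1 in hY1; rewrite hX2 in hY2.
  by rewrite !mkptE; apply/andP; split; apply/eqP; ring: hX1 hY1 hX2 hY2.
apply/negP => l20; move/eqP: l10 => /rowP l10; move/eqP: l20 => /rowP l20.
move: (l10 iT) (l10 iZ) (l20 iT) (l20 iZ) ptP ptQ hX1 hY1 hX2 hY2.
rewrite /jq_law1 /jq_law2 !mkptE !mxE.
move: (P 0 iX) (P 0 iY) (P 0 iT) (P 0 iZ) => X1 Y1 T1 Z1.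
move: (Q 0 iX) (Q 0 iY) (Q 0 iT) (Q 0 iZ) => X2 Y2 T2 Z2.
move=> /eqP + /eqP + /eqP + /eqP; rewrite !sqrf_eq0.
move=> /eqP hB /eqP hA /eqP hC /eqP hD ptP ptQ hX1 hY1 hX2 hY2.
have eq0 (x : F) : 2 * x = 0 -> x = 0.
  by move=> /eqP; rewrite mulf_eq0 (negPf h2) => /eqP.
have XY12 : X1 * Y2 = 0.
  by apply: eq0; transitivity (0 + 0 : F); [rewrite -{1}hB -hD; ring | ring].
have XY21 : X2 * Y1 = 0 by move: hB; rewrite XY12 add0r.
have nz (T T' Z Z' : F) : Z * Z' - eps * (T * T') = 0 -> T * Z' - T' * Z = 0 ->
    (T' = 0 -> Z' = 0 -> False) -> T' * Z' = 0 -> T = 0 /\ Z = 0.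
  move=> h1 h3 pt /eqP; rewrite mulf_eq0 => /orP[] /eqP z0; rewrite z0 in h1 h3 pt.
    have nZ : Z' != 0 by apply/eqP => /pt; apply.
    split; apply/eqP.
      by move/eqP: h3; rewrite mul0r subr0 mulf_eq0 (negPf nZ) orbF.
    by move/eqP: h1; rewrite !mulr0 subr0 mulf_eq0 (negPf nZ) orbF.
  have nT : T' != 0 by apply/eqP => /pt; apply.
  split; apply/eqP.
    move/eqP: h1; rewrite mulr0 sub0r oppr_eq0 !mulf_eq0 (negPf he) (negPf nT).
    by rewrite orbF.
  by move/eqP: h3; rewrite mulr0 sub0r oppr_eq0 mulf_eq0 (negPf nT).
have T2Z2 : T2 * Z2 != 0.
  by apply/eqP => h; case: (nz T1 T2 Z1 Z2 hA hC ptQ h); exact: ptP.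
have T1Z1 : T1 * Z1 != 0.
  apply/eqP => h; case: (nz T2 T1 Z2 Z1 _ _ ptP h); last exact: ptQ.
    by rewrite -hA; ring.
  by rewrite -oppr0 -hC; ring.
have X1N0 : X1 != 0 by rewrite -sqrf_eq0 hX1.
have X2N0 : X2 != 0 by rewrite -sqrf_eq0 hX2.
have Y1E : Y1 = 0 by move/eqP: XY21; rewrite mulf_eq0 (negPf X2N0) => /eqP.
have Y2E : Y2 = 0 by move/eqP: XY12; rewrite mulf_eq0 (negPf X1N0) => /eqP.
move: T1Z1 T2Z2; rewrite !mulf_eq0 !negb_or => /andP[T1N Z1N] /andP[T2N Z2N].
have hT : T1 = T2 * Z1 / Z2.
  by move/eqP: hC; rewrite subr_eq0 => /eqP <-; rewrite mulfK.
have hE : Z2 ^+ 2 = eps * T2 ^+ 2.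
  move: hA; rewrite hT => hA; apply/eqP; rewrite -subr_eq0 -(mulrI_eq0 _ (mulfI Z1N)).
  have -> : Z1 * (Z2 ^+ 2 - eps * T2 ^+ 2)
    = Z2 * (Z1 * Z2 - eps * (T2 * Z1 / Z2 * T2)) by field.
  by rewrite hA mulr0.
have hdl : Z2 = - (delta * T2).
  apply: (mulfI Z2N); apply/eqP; rewrite -subr_eq0; apply/eqP; apply: eq0.
  transitivity (eps * T2 ^+ 2 + 2 * delta * X2 ^+ 2 + Z2 ^+ 2).
    by rewrite hX2 -hE; ring.
  by rewrite -hY2 Y2E expr0n.
move/eqP: hd; apply; apply: (mulIf (expf_neq0 2 T2N)).
by rewrite -hE hdl; ring.
Qed.

Lemma jq_add_affine (x1 y1 x2 y2 : F) : 1 - eps * x1 ^+ 2 * x2 ^+ 2 != 0 ->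
  let x3 := (x1 * y2 + x2 * y1) / (1 - eps * x1 ^+ 2 * x2 ^+ 2) in
  let y3 := ((y1 * y2 + 2 * delta * x1 * x2) * (1 + eps * x1 ^+ 2 * x2 ^+ 2)
              + 2 * eps * x1 * x2 * (x1 ^+ 2 + x2 ^+ 2))
            / (1 - eps * x1 ^+ 2 * x2 ^+ 2) ^+ 2 in
  proj_eq (jq_add (mkpt x1 y1 (x1 ^+ 2) 1) (mkpt x2 y2 (x2 ^+ 2) 1))
          (mkpt x3 y3 (x3 ^+ 2) 1).
Proof.
move=> hd x3 y3; exists ((1 - eps * x1 ^+ 2 * x2 ^+ 2) ^+ 2).
  exact: expf_neq0.
rewrite /jq_add; case: eqP => [/rowP /(_ iZ)|_].
  rewrite /jq_law1 !mkptE mxE !mulr1 => /eqP; rewrite sqrf_eq0 mulrA.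
  by rewrite (negPf hd).
rewrite /x3 /y3 /jq_law1.
by apply: pt_eqP; rewrite [RHS]mxE !mkptE; field.
Qed.

End JacobiQuartic.

(* Main.v *)
Require Import Defs.
From mathcomp Require Import all_boot all_order all_algebra.
From mathcomp Require Import ring mpoly.
Set Implicit Arguments.
Unset Strict Implicit.
Unset Printing Implicit Defensive.
Import GRing.Theory.
Local Open Scope ring_scope.

(** Everything is a computation in homogeneous coordinates modulo the two
    quadrics; the work is in the degenerate cases, where the addition law in
    use changes or a coordinate pair could become (0 : 0).

    Evaluation. X and Y have no common zero on the curve, so the pair
    (2 s X^2 : Y^2) represents w at every point, poles included
    ([jq_value_wcoord]).

    Doubling. In affine coordinates, with W = 2 s x^2 and Z = y^2,
      (W + Z)^2 - e W Z = (1 - eps x^4)^2,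
    because s e = 2 (delta + s) and s^2 = delta^2 - eps, while Z^2 - W^2 is
    the numerator of the ordinate of 2 P. Both coordinates of w(2 P) can be
    read off ([wcoord_double]).

    Differential addition. Let n = x1 y2 + x2 y1, n' = x2 y1 - x1 y2 and
    d = 1 - eps x1^2 x2^2, so that P1 + P2 and P2 - P1 have abscissas n / d
    and n' / d. Then n n' is, up to the factor -2 s, the cross difference
    W1 Z2 - W2 Z1 ([wdiffE]), and the product of the ordinates of P1 + P2 and
    P2 - P1 is, up to sign and powers of d, the form W1 W2 - Z1 Z2
    ([law1_Y_mul]). Dividing the square of the first identity by the square
    of the second gives w(P1 + P2) w(P2 - P1), which is the claim whenever the
    right-hand side is a point of the projective line.

    When W0 Z0 <> 0, the first addition law is valid for P1 + P2: its only
    failure has n = d = 0, and then P2 - P1 has X = 0 by whichever law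
    computes it. It may fail for P2 - P1, in which case n' = d = 0, and
    [law12_Y_mul] takes the place of [law1_Y_mul]. In both cases the vanishing
    of W1 Z2 - W2 Z1 forces X = 0 at P1 + P2, and the vanishing of
    W1 W2 - Z1 Z2 forces Y = 0 there; since no point of the curve has
    X = Y = 0, the right-hand side is never (0 : 0) ([wcoord_dadd]). *)

(** * Equality of points of the projective line *)

Section ProjectiveLine.
Variable F : fieldType.
Implicit Types a b c : F * F.

Lemma P1_eq_sym a b : P1_eq a b -> P1_eq b a.
Proof.
case=> k k0 ->; exists k^-1; first by rewrite invr_eq0.
by rewrite /= !mulKf // -surjective_pairing.
Qed.

Lemma P1_eq_trans a b c : P1_eq a b -> P1_eq b c -> P1_eq a c.
Proof.
case=> k k0 -> [l l0 ->]; exists (k * l); first by rewrite mulf_neq0.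
by rewrite /= !mulrA.
Qed.

Lemma P1_eq_cross a b : a != (0, 0) -> b != (0, 0) ->
  a.1 * b.2 = a.2 * b.1 -> P1_eq a b.
Proof.
case: a b => [a1 a2] [b1 b2]; rewrite !xpair_eqE !negb_and /= => a0 b0 hab.
have [b10|b1N] := eqVneq b1 0.
  rewrite b10 eqxx /= in b0; rewrite b10 mulr0 in hab.
  have a10 : a1 = 0 by move/eqP: hab; rewrite mulf_eq0 (negPf b0) orbF => /eqP.
  rewrite a10 eqxx /= in a0.
  exists (a2 / b2); first by rewrite mulf_neq0 ?invr_eq0.
  by rewrite a10 b10 /= mulr0 divfK.
exists (a1 / b1) => /=; last by rewrite divfK // mulrAC hab mulfK.
rewrite mulf_neq0 ?invr_eq0 //; apply/eqP => a10.
rewrite a10 eqxx /= in a0; move/eqP: hab; rewrite a10 mul0r eq_sym.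
by rewrite mulf_eq0 (negPf a0) (negPf b1N).
Qed.

End ProjectiveLine.

(** * Coordinates of sums and differences *)

Section DifferentialAddition.
Variables (F : fieldType) (eps delta s : F).
Hypotheses (h2 : 2 != 0 :> F) (heps : eps != 0) (hs0 : s != 0).
Hypothesis hs : s ^+ 2 = delta ^+ 2 - eps.
Implicit Types P Q : 'rV[F]_4.

Local Notation law1 := (jq_law1 eps delta).
Local Notation law2 := (jq_law2 eps delta).
Local Notation add := (jq_add eps delta).
Local Notation on := (on_jq eps delta).

Definition wcoord P : F * F := (2 * s * P 0 iX ^+ 2, P 0 iY ^+ 2).

Definition law_num P Q : F := P 0 iX * Q 0 iY + Q 0 iX * P 0 iY.
Definition law_den P Q : F := P 0 iZ * Q 0 iZ - eps * (P 0 iT * Q 0 iT).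

(** [wprod] and [wdiff] are the homogeneous forms of w(P) w(Q) - 1 and of
    w(P) - w(Q). *)
Definition wprod P Q : F :=
  (wcoord P).1 * (wcoord Q).1 - (wcoord P).2 * (wcoord Q).2.
Definition wdiff P Q : F :=
  (wcoord P).1 * (wcoord Q).2 - (wcoord Q).1 * (wcoord P).2.

Lemma law1E P Q :
  ((law1 P Q 0 iX = (law_num P Q * law_den P Q)%R)
  * (law1 P Q 0 iT = (law_num P Q ^+ 2)%R)
  * (law1 P Q 0 iZ = (law_den P Q ^+ 2)%R))%type.
Proof. by rewrite /jq_law1 !mkptE. Qed.

Lemma oppE P :
  ((jq_opp P 0 iX = (- P 0 iX)%R) * (jq_opp P 0 iY = P 0 iY)
  * (jq_opp P 0 iT = P 0 iT) * (jq_opp P 0 iZ = P 0 iZ))%type.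
Proof. by rewrite /jq_opp !mkptE. Qed.

Lemma on_jq_opp P : on P -> on (jq_opp P).
Proof.
rewrite !on_jqE !oppE sqrrN => /and3P[P0 -> ->]; rewrite !andbT.
apply: contraNneq P0 => /rowP oP0; apply/eqP/pt_eqP; rewrite mxE.
- by apply/eqP; rewrite -oppr_eq0 -(oppE P) oP0 mxE.
- by rewrite -(oppE P) oP0 mxE.
- by rewrite -(oppE P) oP0 mxE.
- by rewrite -(oppE P) oP0 mxE.
Qed.

(** [law_num P Q] and [law_num Q (jq_opp P)] are X1 Y2 + X2 Y1 and
    X2 Y1 - X1 Y2, so this is a difference of squares. *)
Lemma wdiffE P Q :
  wdiff P Q = - (2 * s * (law_num P Q * law_num Q (jq_opp P))).
Proof. by rewrite /wdiff /law_num !oppE /=; ring. Qed.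

Lemma law_denN P Q : law_den Q (jq_opp P) = law_den P Q.
Proof. by rewrite /law_den !oppE; ring. Qed.

(** The second law for Q - P has the numerator of the first law for P + Q as
    its denominator, which ties the failure of one to that of the other. *)
Lemma law2_oppX P Q : law2 Q (jq_opp P) 0 iX
  = (Q 0 iT * P 0 iZ - P 0 iT * Q 0 iZ) * law_num P Q.
Proof. by rewrite /jq_law2 /law_num !oppE !mkptE; ring. Qed.

(** With s^2 = delta^2 - eps, the product of the ordinates of P + Q and Q - P
    involves the coordinates of P and Q only through X^2 and Y^2, apart from
    the common denominator. *)
Lemma law1_Y_mul P Q : on P -> on Q ->
  law1 P Q 0 iY * law1 Q (jq_opp P) 0 iY = - law_den P Q ^+ 2 * wprod P Q.
Proof.
rewrite !on_jqE => /and3P[_ /eqP hX1 /eqP hY1] /and3P[_ /eqP hX2 /eqP hY2].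
rewrite /wprod /law_den /jq_law1 !oppE !mkptE /=.
move: (P 0 iX) (P 0 iY) (P 0 iT) (P 0 iZ) hX1 hY1 => X1 Y1 T1 Z1 hX1 hY1.
move: (Q 0 iX) (Q 0 iY) (Q 0 iT) (Q 0 iZ) hX2 hY2 => X2 Y2 T2 Z2 hX2 hY2.
rewrite hX1 in hY1; rewrite hX2 in hY2.
ring: hs hX1 hY1 hX2 hY2.
Qed.

(** Where the first law vanishes at (Q, - P), [law_den P Q] is 0 and
    [law1_Y_mul] says nothing about [wprod P Q]. Replacing the first law by the
    second for Q - P trades the factor [law_den P Q] for [law_num P Q]. *)
Lemma law12_Y_mul P Q : on P -> on Q ->
  law1 P Q 0 iY * law2 Q (jq_opp P) 0 iY = - law_num P Q ^+ 2 * wprod P Q.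
Proof.
rewrite !on_jqE => /and3P[_ /eqP hX1 /eqP hY1] /and3P[_ /eqP hX2 /eqP hY2].
rewrite /wprod /law_num /jq_law1 /jq_law2 !oppE !mkptE /=.
move: (P 0 iX) (P 0 iY) (P 0 iT) (P 0 iZ) hX1 hY1 => X1 Y1 T1 Z1 hX1 hY1.
move: (Q 0 iX) (Q 0 iY) (Q 0 iT) (Q 0 iZ) hX2 hY2 => X2 Y2 T2 Z2 hX2 hY2.
rewrite hX1 in hY1; rewrite hX2 in hY2.
ring: hs hX1 hY1 hX2 hY2.
Qed.

(** X = Y = 0 would give T Z = 0 and eps T^2 + Z^2 = 0, hence T = Z = 0. *)
Lemma wcoord_neq0 P : on P -> wcoord P != (0, 0).
Proof.
rewrite on_jqE => /and3P[P0 /eqP hX /eqP hY]; apply: contraNneq P0.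
case=> /eqP; rewrite !mulf_eq0 (negPf h2) (negPf hs0) !orbb /= => /eqP X0.
move=> /eqP; rewrite mulf_eq0 orbb => /eqP Y0.
move: hX hY; rewrite X0 Y0 !expr0n /= mulr0 addr0.
move=> /esym/eqP; rewrite mulf_eq0 => /orP[] /eqP T0.
  rewrite T0 expr0n mulr0 add0r => /esym/eqP; rewrite sqrf_eq0 => /eqP Z0.
  by apply/eqP/pt_eqP; rewrite ?mxE.
rewrite T0 expr0n addr0 => /esym/eqP; rewrite mulf_eq0 (negPf heps) sqrf_eq0.
by move=> /eqP Z0; apply/eqP/pt_eqP; rewrite ?mxE.
Qed.

Lemma add_on P Q : on P -> on Q -> on (add P Q).
Proof.
apply: jq_add_on => //; rewrite -subr_eq0 -hs; exact: expf_neq0.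
Qed.

Lemma jq_addE P Q : law1 P Q != 0 -> add P Q = law1 P Q.
Proof. by rewrite /jq_add => /negPf ->. Qed.

Lemma law1_neq0P P Q :
  reflect (law_num P Q = 0 /\ law_den P Q = 0 /\ law1 P Q 0 iY = 0)
          (law1 P Q == 0).
Proof.
apply: (iffP eqP) => [h|[n0 [d0 Y0]]]; last first.
  apply: pt_eqP; rewrite ?law1E ?Y0 ?n0 ?d0 [RHS]mxE ?mulr0 ?expr0n //.
have hT : law1 P Q 0 iT = 0 by rewrite h mxE.
have hZ : law1 P Q 0 iZ = 0 by rewrite h mxE.
rewrite !law1E in hT hZ; rewrite h mxE.
by split; [|split]; apply/eqP; rewrite // -sqrf_eq0 ?hT ?hZ.
Qed.

(** For equal arguments the second law has X = T = Z = 0, so it cannot stand in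
    for the first one: their common zero is excluded as the sum must lie on the
    curve. *)
Lemma law1_diag_neq0 P : on P -> law1 P P != 0.
Proof.
move=> hP; apply/negP => l0; have := add_on hP hP.
rewrite /jq_add l0 => hS; have := wcoord_neq0 hS; case/negP.
move: hS; rewrite on_jqE => /and3P[_ _ /eqP hY].
rewrite /wcoord hY /jq_law2 !mkptE; apply/eqP; congr pair; ring.
Qed.

(** * The two formulas for w *)

(** The first law gives the right-hand side exactly, with proportionality
    factor 1. *)
Lemma wcoord_double P : on P ->
  P1_eq (wcoord (add P P))
    (let: (W, Z) := wcoord P in
     (4 * W * Z * ((W + Z) ^+ 2 - (2 * (delta + s) / s) * W * Z),
      (W ^+ 2 - Z ^+ 2) ^+ 2)).
Proof.
move=> hP; rewrite jq_addE ?law1_diag_neq0 // /wcoord.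
move: hP; rewrite on_jqE /jq_law1 !mkptE => /and3P[_ /eqP hX /eqP hY].
move: (P 0 iX) (P 0 iY) (P 0 iT) (P 0 iZ) hX hY => X Y T Z hX hY.
rewrite hX in hY.
exists 1; rewrite ?oner_neq0 //= !mul1r; congr pair; last first.
  ring: hs hX hY.
(* The division by s in e cancels against the factor s of W. *)
have -> : 2 * (delta + s) / s * (2 * s * X ^+ 2) * Y ^+ 2
  = 4 * (delta + s) * X ^+ 2 * Y ^+ 2 by field.
ring: hs hX hY.
Qed.

(** The hypothesis on D is what keeps the right-hand side away from (0 : 0): if
    w(P) = w(Q) = +-1, both [wdiff] and [wprod] vanish, and then D is a zero or
    a pole of w. *)
Lemma wcoord_dadd P Q (D := add Q (jq_opp P)) : on P -> on Q ->
  (wcoord D).1 * (wcoord D).2 != 0 ->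
  P1_eq (wcoord (add P Q))
    ((wcoord D).2 * wdiff P Q ^+ 2, (wcoord D).1 * wprod P Q ^+ 2).
Proof.
move=> hP hQ; have hS := add_on hP hQ.
rewrite /= mulf_eq0 mulf_eq0 !sqrf_eq0 !negb_or => /andP[/andP[_ XD] YD].
have YN := law1_Y_mul hP hQ; have YN2 := law12_Y_mul hP hQ.
have M := wdiffE P Q.
have key : [/\ law1 P Q != 0, wdiff P Q = 0 -> law1 P Q 0 iX = 0,
    wprod P Q = 0 -> law1 P Q 0 iY = 0 &
    (wcoord (law1 P Q)).1 * ((wcoord D).1 * wprod P Q ^+ 2)
    = (wcoord (law1 P Q)).2 * ((wcoord D).2 * wdiff P Q ^+ 2)].
  move: XD YD; rewrite {}/D /jq_add /wcoord /=.
  (* The first law fails for Q - P only when P + Q is one of the 2-torsion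
     points (0 : +-sqrt eps : 1 : 0), where w = 0; the cross product is then
     0 = 0. *)
  case: ifPn => [/law1_neq0P[n0 [d0 _]] | _].
    rewrite law_denN in d0; set Y0 := law2 _ _ 0 iY; move=> XD YD.
    have nN0 : law_num P Q != 0.
      by apply: contraNneq XD => nN0; rewrite law2_oppX nN0 mulr0.
    rewrite !law1E d0 M n0; split; last by ring.
    - by apply/negP => /law1_neq0P[/eqP]; rewrite (negPf nN0).
    - by rewrite mulr0.
    - move=> N0; move: YN2; rewrite N0 mulr0 => /eqP.
      by rewrite mulf_eq0 (negPf YD) orbF => /eqP.
  set Y0 := law1 _ _ 0 iY; rewrite !law1E law_denN mulf_eq0 negb_or.
  move=> /andP[n0 d0] YD.
  split.
  - by apply/negP => /law1_neq0P[_ [/eqP]]; rewrite (negPf d0).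
  - rewrite M => /eqP; rewrite oppr_eq0 !mulf_eq0 (negPf h2) (negPf hs0).
    by rewrite (negPf n0) /= orbF => /eqP ->; rewrite mul0r.
  - move=> N0; move: YN; rewrite N0 mulr0 => /eqP.
    by rewrite mulf_eq0 (negPf YD) orbF => /eqP.
  - by rewrite [RHS]mulrA -exprMn YN M; ring.
case: key => S0 M0 N0 cross; rewrite jq_addE // in hS *.
have SN0 := wcoord_neq0 hS.
apply: P1_eq_cross => //; apply: contraNneq SN0 => -[].
move=> /eqP; rewrite mulf_eq0 !sqrf_eq0 (negPf YD) /= => /eqP /M0 X0.
move=> /eqP; rewrite !mulf_eq0 !orbb (negPf h2) (negPf hs0) (negPf XD) /=.
by move=> /eqP /N0 Y0; rewrite /wcoord X0 Y0 expr0n mulr0.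
Qed.

(** * The values of the rational function w *)

Lemma jq_x2y2_ratfun : jq_ratfun eps delta (jq_x2y2 (2 * s)).
Proof.
split=> /=.
  (* At the point (0 : 1 : 0 : 1) of the curve, Y^2 takes the value 1. *)
  case=> a [b /(congr1 (meval (mkpt (0 : F) 1 0 1 0)))].
  rewrite mevalD !mevalM /jq_eq1 /jq_eq2.
  rewrite !(mevalB, mevalD, mevalZ, mevalM, rmorphXn) /= !mevalXU !mkptE.
  rewrite !mulr0 mul0r mulr1 !add0r !subrr oppr0 !mulr0 addr0 => /eqP.
  by rewrite oner_eq0.
have hom (i : 'I_4) : ('X_i ^+ 2 : {mpoly F[4]}) \is 2.-homog.
  by apply: (@dhomogMn _ _ _ 1) 2 _; rewrite dhomogX /= mdeg1.
by exists 2; split; [apply: dhomogZ; exact: hom | exact: hom].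
Qed.

Lemma jq_x2y2_even : jq_even eps delta (jq_x2y2 (2 * s)).
Proof.
exists 0, 0; rewrite /jq_ratfun_opp /=.
by rewrite comp_mpolyZ !rmorphXn /= !comp_mpolyXU /= sqrrN !mul0r addr0 subrr.
Qed.

(** Two fractions representing w have equal cross products on the curve, so any
    one regular at P gives the value 2 s X^2 / Y^2. If none is regular at P then
    Y = 0 there, since the defining fraction is one of them. *)
Lemma jq_value_wcoord P c : on P ->
  jq_value eps delta (jq_x2y2 (2 * s)) P c -> P1_eq c (wcoord P).
Proof.
move=> hP; have [hX hY] : (jq_eq1 F).@[P 0] = 0 /\ (jq_eq2 eps delta).@[P 0] = 0.
  by case/and3P: hP => _ /eqP ? /eqP ?.
case=> [[u [_ [a [b /(congr1 (meval (P 0))) e]] u20] cu]|[nreg c10]].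
  apply: (P1_eq_trans cu); apply: P1_eq_cross (wcoord_neq0 hP) _.
    by rewrite xpair_eqE oner_eq0 andbF.
  move: e; rewrite mevalB mevalD !mevalM hX hY !mulr0 addr0.
  rewrite !(mevalZ, rmorphXn) /= !mevalXU => /eqP; rewrite subr_eq0 => /eqP e.
  by rewrite /= mul1r mulrAC -e mulfK.
suff Y0 : P 0 iY = 0.
  apply: (P1_eq_trans c10); apply: P1_eq_cross (wcoord_neq0 hP) _.
    by rewrite xpair_eqE oner_eq0.
  by rewrite /= Y0 expr0n mul1r mul0r.
apply/eqP/negPn/negP => Y0; apply: nreg; exists (jq_x2y2 (2 * s)); split.
- exact: jq_x2y2_ratfun.
- by exists 0, 0; rewrite subrr !mul0r addr0.
- by rewrite /= rmorphXn /= mevalXU expf_neq0.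
Qed.

(** The formulas are bihomogeneous, so replacing each given pair (Wi, Zi) by
    [wcoord] at the same point only changes a nonzero factor. *)
Lemma jq_x2y2_inverted_montgomery_like :
  inverted_montgomery_like eps delta (jq_x2y2 (2 * s)) (2 * (delta + s) / s).
Proof.
split; [exact: jq_x2y2_ratfun | exact: jq_x2y2_even | move=> P Q hP hQ].
have hD := add_on hQ (on_jq_opp hP).
move=> W0 Z0 W1 Z1 W2 Z2 W3 Z3 W4 Z4.
move=> /(jq_value_wcoord hD)[k0 k0N [-> ->]].
move=> /(jq_value_wcoord hP)[k1 k1N [-> ->]].
move=> /(jq_value_wcoord hQ)[k2 k2N [-> ->]].
move=> /(jq_value_wcoord (add_on hP hQ)) h3.
move=> /(jq_value_wcoord (add_on hP hP)) h4.
rewrite mulrACA mulf_eq0 negb_or => /andP[_ D0]; split.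
  apply: (P1_eq_trans h4); apply: (P1_eq_trans (wcoord_double hP)).
  apply: P1_eq_sym; exists (k1 ^+ 4); first exact: expf_neq0.
  by case: (wcoord P) => W Z /=; congr pair; ring.
apply: (P1_eq_trans h3); apply: (P1_eq_trans (wcoord_dadd hP hQ D0)).
apply: P1_eq_sym; exists (k0 * (k1 * k2) ^+ 2).
  by rewrite mulf_neq0 ?expf_neq0 ?mulf_neq0.
by rewrite /wdiff /wprod /=; congr pair; ring.
Qed.

End DifferentialAddition.

Theorem proposition6 (F : finFieldType) (eps delta : F)
  (hchar : 2%N \notin [pchar F])
  (hsmooth : eps * (delta ^+ 2 - eps) != 0)
  (hchi : quad_char (delta ^+ 2 - eps) = 1)
  (s : F) (hs : s ^+ 2 = delta ^+ 2 - eps) :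
  inverted_montgomery_like eps delta (jq_x2y2 (2 * s))
    (2 * (delta + s) / s).
Proof.
move: hsmooth; rewrite mulf_eq0 negb_or -hs sqrf_eq0 => /andP[heps hs0].
by apply: jq_x2y2_inverted_montgomery_like => //; move: hchar; rewrite inE.
Qed.
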